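(* Let $T$ be a complete first order theory and assume that $T$ has NIP. Then $T$ has DEERP if and only if $T$ has EDEERP.
   Context: Let $\mathfrak{C}$ be a monster model of $T$. For a finite tuple $\bar a$ in $\mathfrak{C}$ and $C\subseteq\mathfrak{C}$, $\binom{C}{\bar a}$ is the set of tuples $\bar a'\in C^{|\bar a|}$ with $\bar a'\equiv\bar a$ (same type over $\emptyset$); for finite $B\subseteq\mathfrak{C}$, $\binom{\mathfrak{C}}{B}$ is the set of images of $B$ under $\mathrm{Aut}(\mathfrak{C})$. A coloring $c\colon\binom{\mathfrak{C}}{\bar a}\to 2^n$ is definable if there are formulas $\varphi_i(\bar x)$, $i<n$, with parameters from $\mathfrak{C}$ such that $c(\bar a')(i)=1$ if $\models\varphi_i(\bar a')$ and $c(\bar a')(i)=0$ if $\models\neg\varphi_i(\bar a')$. It is externally definable if there are formulas without parameters $\varphi_i(\bar x,\bar y)$ and complete types $p_i(\bar y)\in S_{\bar y}(\mathfrak{C})$, $i<n$, such that $c(\bar a')(i)=1$ if $\varphi_i(\bar a',\bar y)\in p_i(\bar y)$ and $c(\bar a')(i)=0$ if $\neg\varphi_i(\bar a',\bar y)\in p_i(\bar y)$. $T$ has DEERP [resp. EDEERP] if for every finite $B\subseteq\mathfrak{C}$, every finite tuple $\bar a\subseteq B$, every $n<\omega$ and every definable [resp. externally definable] coloring $c\colon\binom{\mathfrak{C}}{\bar a}\to 2^n$ there is $B'\in\binom{\mathfrak{C}}{B}$ with $|c[\binom{B'}{\bar a}]|=1$. *)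

(* Defs.v *)
From mathcomp Require Import all_boot all_classical.

Set Implicit Arguments.
Unset Strict Implicit.
Unset Printing Implicit Defensive.

Local Open Scope classical_set_scope.
Local Open Scope card_scope.

Record language := Language {
  fsym : nat -> Type;  (* indexed by arity; constants have arity 0 *)
  rsym : nat -> Type
}.

Inductive term (L : language) (V : Type) :=
| TVar (x : V)
| TApp (n : nat) (f : fsym L n) (ts : 'I_n -> term L V).

(* [formula L V]: formulas whose free variables are among V.  A quantifier
   binds the variable [None] of [option V].  Taking for V
   - ['I_k]       gives formulas phi(x_0, ..., x_(k-1)),
   - ['I_k + 'I_m] gives partitioned formulas phi(x; y),
   - ['I_k + P]   gives formulas phi(x) with parameters from P. *)
Inductive formula (L : language) (V : Type) :=
| FEq (s t : term L V)
| FRel (n : nat) (r : rsym L n) (ts : 'I_n -> term L V)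
| FNot (phi : formula L V)
| FAnd (phi psi : formula L V)
| FEx (phi : formula L (option V)).

Definition sentence (L : language) := formula L void.

Fixpoint rename_term L V W (f : V -> W) (t : term L V) : term L W :=
  match t with
  | TVar x => TVar L (f x)
  | TApp n g ts => TApp g (fun i => rename_term f (ts i))
  end.

Fixpoint rename L V W (f : V -> W) (phi : formula L V) : formula L W :=
  match phi with
  | FEq s t => FEq (rename_term f s) (rename_term f t)
  | FRel n r ts => FRel r (fun i => rename_term f (ts i))
  | FNot phi => FNot (rename f phi)
  | FAnd phi psi => FAnd (rename f phi) (rename f psi)
  | FEx phi => FEx (rename (omap f) phi)
  end.

Record structure (L : language) := Structure {
  carrier :> Type;
  carrier_inhabited : inhabited carrier;
  finterp : forall n, fsym L n -> ('I_n -> carrier) -> carrier;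
  rinterp : forall n, rsym L n -> ('I_n -> carrier) -> Prop
}.

Fixpoint eval L (M : structure L) V (v : V -> M) (t : term L V) : M :=
  match t with
  | TVar x => v x
  | TApp n f ts => finterp f (fun i => eval v (ts i))
  end.

Fixpoint sat L (M : structure L) V (v : V -> M) (phi : formula L V) : Prop :=
  match phi with
  | FEq s t => eval v s = eval v t
  | FRel n r ts => rinterp r (fun i => eval v (ts i))
  | FNot phi => ~ sat v phi
  | FAnd phi psi => sat v phi /\ sat v psi
  | FEx phi => exists x : M, sat (fun o => if o is Some y then v y else x) phi
  end.

Definition assign V W (X : Type) (v : V -> X) (w : W -> X) (z : V + W) : X :=
  match z with inl x => v x | inr y => w y end.

Definition holds L (M : structure L) (phi : sentence L) : Prop :=
  sat (of_void M) phi.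

Definition model L (T : set (sentence L)) (M : structure L) : Prop :=
  forall phi, T phi -> holds M phi.

Definition entails L (T : set (sentence L)) (phi : sentence L) : Prop :=
  forall M : structure L, model T M -> holds M phi.

Definition complete_theory L (T : set (sentence L)) : Prop :=
  (exists M : structure L, model T M) /\
  (forall phi, entails T phi \/ entails T (FNot phi)).

Definition has_IP L (T : set (sentence L)) k m
    (phi : formula L ('I_k + 'I_m)) : Prop :=
  exists M : structure L, model T M /\
  exists (a : nat -> 'I_k -> M) (b : set nat -> 'I_m -> M),
    forall (i : nat) (S : set nat), sat (assign (a i) (b S)) phi <-> S i.

Definition NIP L (T : set (sentence L)) : Prop :=
  forall k m (phi : formula L ('I_k + 'I_m)), ~ has_IP T phi.

Definition same_type L (M : structure L) k (a b : 'I_k -> M) : Prop :=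
  forall phi : formula L 'I_k, sat a phi <-> sat b phi.

(* [p] is a complete m-type of M over the parameters [e : P -> M]: for a set
   A of parameters take P := A and e the inclusion; S_m(M) is [e := id]. *)
Definition complete_type L (M : structure L) (P : Type) (e : P -> M) m
    (p : set (formula L ('I_m + P))) : Prop :=
  (forall F, finite_set F -> F `<=` p ->
     exists v : 'I_m -> M, forall phi, F phi -> sat (assign v e) phi) /\
  (forall phi, p phi \/ p (FNot phi)).

Definition automorphism L (M : structure L) (s : M -> M) : Prop :=
  [/\ bijective s,
      (forall n (f : fsym L n) (v : 'I_n -> M),
         s (finterp f v) = finterp f (s \o v)) &
      (forall n (r : rsym L n) (v : 'I_n -> M),
         rinterp r v <-> rinterp r (s \o v))].

(* Cardinals are represented by types; [smaller A K] is |A| < |K|. *)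
Definition smaller X (A : set X) (K : Type) : Prop := ~~ ([set: K] #<= A).

Definition saturated L (K : Type) (M : structure L) : Prop :=
  forall A : set M, smaller A K ->
  forall m (p : set (formula L ('I_m + A))),
    complete_type (fun x : A => val x) p ->
    exists v : 'I_m -> M,
      forall phi, p phi -> sat (assign v (fun x : A => val x)) phi.

Definition strongly_homogeneous L (K : Type) (M : structure L) : Prop :=
  forall (A : set M) (f : M -> M), smaller A K ->
    (forall k (a : 'I_k -> M), (forall i, A (a i)) -> same_type a (f \o a)) ->
    exists s : M -> M, automorphism s /\ (forall x, A x -> s x = f x).

(* M is K-saturated and strongly K-homogeneous for some K > |L| + aleph_0,
   the latter being the cardinality of [formula L nat]. *)
Definition monster L (T : set (sentence L)) (M : structure L) : Prop :=
  model T M /\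
  exists K : Type, [/\ smaller [set: formula L nat] K, saturated K M &
                       strongly_homogeneous K M].

Definition copies L (M : structure L) k (B : set M) (a : 'I_k -> M)
    : set ('I_k -> M) :=
  [set a' | (forall i, B (a' i)) /\ same_type a' a].

Definition set_copies L (M : structure L) (B : set M) : set (set M) :=
  [set B' | exists s : M -> M, automorphism s /\ B' = s @` B].

(* A coloring of [copies [set: M] a] is given by a function on all k-tuples
   of which only the values on [copies [set: M] a] are ever used. *)
Definition coloring (M : Type) k n := ('I_k -> M) -> {ffun 'I_n -> bool}.

Definition definable L (M : structure L) k n (a : 'I_k -> M)
    (c : coloring M k n) : Prop :=
  exists phi : 'I_n -> formula L ('I_k + M),
    forall a', copies [set: M] a a' -> forall i,
      (sat (assign a' id) (phi i) -> c a' i = true) /\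
      (sat (assign a' id) (FNot (phi i)) -> c a' i = false).

(* phi(a', y), as a formula in y with parameters from M *)
Definition subst_left L (M : structure L) k m (a' : 'I_k -> M)
    (phi : formula L ('I_k + 'I_m)) : formula L ('I_m + M) :=
  rename (assign (fun j => inr (a' j)) (fun j => inl j)) phi.

Definition externally_definable L (M : structure L) k n (a : 'I_k -> M)
    (c : coloring M k n) : Prop :=
  exists (m : nat) (phi : 'I_n -> formula L ('I_k + 'I_m))
         (p : 'I_n -> set (formula L ('I_m + M))),
    (forall i, complete_type id (p i)) /\
    forall a', copies [set: M] a a' -> forall i,
      (p i (subst_left a' (phi i)) -> c a' i = true) /\
      (p i (FNot (subst_left a' (phi i))) -> c a' i = false).

Definition monochromatic L (M : structure L) k n (B : set M) (a : 'I_k -> M)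
    (c : coloring M k n) : Prop :=
  exists col, c @` copies B a = [set col].

Definition DEERP L (M : structure L) : Prop :=
  forall (B : set M) k (a : 'I_k -> M) n (c : coloring M k n),
    finite_set B -> (forall i, B (a i)) -> definable a c ->
    exists B', set_copies B B' /\ monochromatic B' a c.

Definition EDEERP L (M : structure L) : Prop :=
  forall (B : set M) k (a : 'I_k -> M) n (c : coloring M k n),
    finite_set B -> (forall i, B (a i)) -> externally_definable a c ->
    exists B', set_copies B B' /\ monochromatic B' a c.

(* Main.v *)
Require Import Defs.
From mathcomp Require Import all_boot all_classical.

(** The easy direction: a coloring defined by formulas with parameters is
defined externally by the type over the model of the tuple of all these
parameters.

For the converse, let M be the monster model, B finite, a a tuple in B, and c
an externally definable coloring of the conjugates of a. It is enough to find
an automorphism t giving one and the same color to all t b, for b a conjugate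
of a in B. Three ideas combine.

Invariant types. DEERP says that finitely many formulas can be prevented from
distinguishing finitely many conjugate tuples, once these are moved by a
suitable automorphism; moving the parameters by the inverse automorphism
instead, and passing to a limit, one gets an ultrafilter V on self-maps of M,
concentrated on automorphisms, for which the limit type of every tuple b (all
phi(x, e) such that phi(s b, e) for V-almost all s) is invariant under all
automorphisms ([DEERP_invariant_ultrafilter]). The limit types of all tuples
come coherently from one V, so that a type invariant in this sense can always
be extended to more variables.

Inseparable pairs and NIP. Let s a realize the limit type of a over B, and b be
a conjugate of a in B. Then (b, s a) starts a Morley sequence, and averaging V
along this sequence gives another such ultrafilter, for which b and s a have
the same limit type ([morley_inseparable]). Take now a Morley sequence of
copies of this pair. Replacing some of the first entries by the corresponding
second entries does not change the type of the sequence of first entries; so if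
a color distinguished the two entries of each pair, every pattern of that color
would be realized along a sequence of one fixed type, contradicting NIP
([NIP_tame]). Hence the color agrees on some pair of any such sequence, even
after an arbitrary automorphism.

The broom. All pairs (b, s a) have to be treated at once. This is the argument
by which Chernikov and Kaplan prove that forking implies quasi-dividing.
Suppose that some conditions on a finite set X can already be achieved by
automorphisms, with prescribed values on any set free over X. To add one
inseparable pair in X, take a Morley sequence of copies of X. The later copies
are free over the earlier ones, so the old conditions can be achieved on all
copies, from the last one to the first one; and on one of the copies the two
entries of the pair get the same color ([solvable_pair]). *)

Set Implicit Arguments.
Unset Strict Implicit.
Unset Printing Implicit Defensive.

Local Open Scope classical_set_scope.
Local Open Scope card_scope.

(** * Finite sets and ultrafilters *)

Lemma finite_set_enum T (A : set T) :
  finite_set A -> exists n (x : 'I_n -> T), A = range x.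
Proof.
move=> /(@finite_seqP {classic T})[s ->]; exists (size s), (tnth (in_tuple s)).
apply/seteqP; split=> [z /= /(tnthP (in_tuple s))[i ->]|z [i _ <-]] /=.
  by exists i.
exact: mem_tnth.
Qed.

Lemma finite_set_range n T (x : 'I_n -> T) : finite_set (range x).
Proof. exact/finite_image/finite_finset. Qed.

Lemma finite_common_bound n T (P : 'I_n -> set T -> Prop) :
  (forall i, exists2 A, finite_set A & P i A) ->
  (forall i A B, A `<=` B -> P i A -> P i B) ->
  exists2 A, finite_set A & forall i, P i A.
Proof.
move=> PA Pmono.
have /choice[A fA] : forall i, exists A, finite_set A /\ P i A.
  by move=> i; case: (PA i) => A; exists A.
exists (\bigcup_(i in [set: 'I_n]) A i) => [|i].
  by apply: bigcup_finite => [|i _]; [exact: finite_finset|case: (fA i)].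
by apply: Pmono (fA i).2 => x Ax; exists i.
Qed.

Lemma filter_finite_bigcap T I (F : set_system T) (D : set I) (f : I -> set T) :
  Filter F -> finite_set D -> (forall i, D i -> F (f i)) ->
  F (\bigcap_(i in D) f i).
Proof.
move=> FF /(@finite_fsetP {classic I})[E ->] Ff.
exact: (@filter_bigI _ {classic I}).
Qed.

Lemma ultra_setC T (F : set_system T) (A : set T) :
  UltraFilter F -> F (~` A) <-> ~ F A.
Proof.
move=> FU; split=> [FnA FA|nFA]; last by case: (in_ultra_setVsetC A FU).
by apply: (@filter_not_empty _ F); rewrite -(setICr A); exact: filterI.
Qed.

Lemma decides_ultra T (F : set_system T) :
  ProperFilter F -> (forall A, F A \/ F (~` A)) -> UltraFilter F.
Proof.
move=> FF Fdec; split=> // G GF FG; apply/seteqP; split=> // A GA.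
case: (Fdec A) => // /FG GnA; case: (@filter_not_empty _ G).
by rewrite -(setICr A); exact: filterI.
Qed.

Lemma ultra_fmap T U (f : T -> U) (F : set_system T) :
  UltraFilter F -> UltraFilter (fmap f F).
Proof.
move=> FU; apply: decides_ultra => A.
exact: (@in_ultra_setVsetC _ _ (f @^-1` A)).
Qed.

Lemma ultra_iff T (F : set_system T) (A B : set T) :
  Filter F -> F [set x | A x <-> B x] -> F A <-> F B.
Proof. by move=> FF FAB; split; apply: filterS2 FAB => x /= []; auto. Qed.

(** * Renaming and finite support of formulas *)

Section Semantics.
Variable L : language.

Lemma eval_rename (M : structure L) V W (f : V -> W) (v : W -> M) (t : term L V) :
  eval v (rename_term f t) = eval (v \o f) t.
Proof.
elim: t => //= n g ts IH; congr finterp.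
by apply: funext => i; exact: IH.
Qed.

Lemma sat_rename (M : structure L) V W (f : V -> W) (v : W -> M) (phi : formula L V) :
  sat v (rename f phi) <-> sat (v \o f) phi.
Proof.
elim: phi W f v => {V} [V s t|V n r ts|V phi IH|V phi IH psi IH'|V phi IH] W f v /=.
- by rewrite !eval_rename.
- suff -> : (fun i => eval v (rename_term f (ts i))) = (fun i => eval (v \o f) (ts i)) by [].
  by apply: funext => i; exact: eval_rename.
- by rewrite IH.
- by rewrite IH IH'.
- split=> -[x]; rewrite ?IH => H; exists x; rewrite ?IH; move: H;
  congr (sat _ _); by apply: funext => -[].
Qed.

Lemma eval_support V (t : term L V) : exists2 A : set V, finite_set A &
  forall (M : structure L) (v w : V -> M),
    (forall x, A x -> v x = w x) -> eval v t = eval w t.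
Proof.
elim: t => [x|n f ts IH].
  by exists [set x] => [|M v w]; [exact: finite_set1|exact].
have [i A B AB tA M v w vw|A fA tA] := finite_common_bound IH.
  by apply: tA => x /AB; exact: vw.
by exists A => // M v w vw /=; congr finterp; apply: funext => i; exact: tA.
Qed.

Lemma sat_support V (phi : formula L V) : exists2 A : set V, finite_set A &
  forall (M : structure L) (v w : V -> M),
    (forall x, A x -> v x = w x) -> sat v phi <-> sat w phi.
Proof.
elim: phi => {V} [V s t|V n r ts|V phi [A fA IH]|V phi [A fA IH] psi [B fB IH']|V phi [A fA IH]].
- have [A fA sA] := eval_support s; have [B fB tB] := eval_support t.
  exists (A `|` B) => [|M v w vw /=]; first by rewrite finite_setU.
  by rewrite (sA _ v w) ?(tB _ v w) // => x xX; apply: vw; [right|left].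
- have [i A B AB tA M v w vw|A fA tA] :=
      finite_common_bound (fun i => eval_support (ts i)).
  + by apply: tA => x /AB; exact: vw.
  + exists A => // M v w vw /=.
    suff -> : (fun i => eval v (ts i)) = (fun i => eval w (ts i)) by [].
    by apply: funext => i; exact: tA.
- by exists A => // M v w vw /=; rewrite (IH M v w vw).
- exists (A `|` B) => [|M v w vw /=]; first by rewrite finite_setU.
  by rewrite (IH M v w) ?(IH' M v w) // => x xX; apply: vw; [right|left].
- exists (Some @^-1` A) => [|M v w vw /=].
    by apply: finite_preimage => // x y _ _ [].
  have vw' z : sat (fun o => if o is Some y then v y else z) phi <->
      sat (fun o => if o is Some y then w y else z) phi.
    by apply: IH => -[x /vw|].
  by split=> -[z /vw' Hz]; exists z.
Qed.


(** * Automorphisms *)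

Section Automorphisms.
Variable M : structure L.

Lemma automorphism_id : @automorphism L M id.
Proof. by split=> //; exists id. Qed.

Lemma automorphism_comp (s t : M -> M) :
  automorphism s -> automorphism t -> automorphism (s \o t).
Proof.
move=> [bs fs rs] [bt ft rt]; split=> [|n f v|n r v]; first exact: bij_comp.
  by rewrite /= ft fs.
by rewrite rt rs.
Qed.

Lemma automorphism_inv (s : M -> M) : automorphism s ->
  exists t, [/\ automorphism t, cancel s t & cancel t s].
Proof.
move=> [[t st ts] fs rs]; exists t; split=> //.
have sv n (v : 'I_n -> M) : s \o (t \o v) = v by apply: funext => i /=; rewrite ts.
split=> [|n f v|n r v]; first by exists s.
  by apply: (can_inj st); rewrite fs sv ts.
by rewrite (rs _ _ (t \o v)) sv.
Qed.

Lemma eval_automorphism (s : M -> M) V (v : V -> M) (t : term L V) :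
  automorphism s -> eval (s \o v) t = s (eval v t).
Proof.
move=> [_ fs _]; elim: t => //= n f ts IH; rewrite fs; congr finterp.
exact: funext.
Qed.

Lemma sat_automorphism (s : M -> M) V (v : V -> M) (phi : formula L V) :
  automorphism s -> sat (s \o v) phi <-> sat v phi.
Proof.
move=> As; have [[t st ts] fs rs] := As.
elim: phi v => {V} [V a b|V n r ts'|V phi IH|V phi IH psi IH'|V phi IH] v /=.
- rewrite !eval_automorphism //; split=> [/(can_inj st)|->] //.
- rewrite (rs _ _ (fun i => eval v (ts' i))); suff -> : (fun i => eval (s \o v) (ts' i)) = s \o (fun i => eval v (ts' i)) by [].
  by apply: funext => i; exact: eval_automorphism.
- by rewrite IH.
- by rewrite IH IH'.
- have E x : (fun o => if o is Some y then s (v y) else s x) =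
      s \o (fun o => if o is Some y then v y else x) by apply: funext => -[].
  split=> -[x]; last by move=> H; exists (s x); rewrite E IH.
  by rewrite -(ts x) E IH => H; exists (t x).
Qed.

End Automorphisms.

(** * Saturation and homogeneity *)

Section Monster.
Variables (M : structure L) (K : Type).
Hypotheses (K_large : smaller [set: formula L nat] K)
  (M_sat : saturated K M) (M_hom : strongly_homogeneous K M).

(** K exceeds the number of formulas in countably many variables, which is
infinite even in the empty language: use the formulas x_n = x_n. *)
Lemma countable_smaller (A : set M) : countable A -> smaller A K.
Proof.
move=> cA; apply: contraNN K_large => KA.
apply: card_le_trans KA (card_le_trans cA _).
pose f (n : nat) : formula L nat := FEq (TVar L n) (TVar L n).
by apply: (@card_ge_preimage _ _ setT f) => m n _ _ [].
Qed.

(** Saturation in the form used below: an ultrafilter on tuples decides every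
formula, and finitely many of its decisions are followed by a common tuple, so
they form a complete type over A. *)
Lemma ultrafilter_realized m (W : set_system ('I_m -> M)) (A : set M) :
  UltraFilter W -> smaller A K -> exists v : 'I_m -> M,
  forall phi : formula L ('I_m + A),
    sat (assign v val) phi <-> W [set y | sat (assign y val) phi].
Proof.
move=> WU sA.
pose p := [set phi : formula L ('I_m + A) | W [set y | sat (assign y val) phi]].
have [|v vp] := M_sat sA (p := p).
  split=> [F fF Fp|phi]; last exact: (in_ultra_setVsetC [set y | sat (assign y val) phi]).
  have /(_ _)/filter_ex[v vF] := filter_finite_bigcap (F := W) _ fF Fp.
  by exists v.
exists v => phi; split=> [vphi|]; last exact: vp.
case: (in_ultra_setVsetC [set y | sat (assign y val) phi] WU) => // nphi.
by case: (vp (FNot phi) nphi).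
Qed.

(** Strong homogeneity for finite families. The index type is arbitrary, so that
tuples, finite sets and mixtures of the two can be moved simultaneously. The
assignment x i |-> v i is well defined since equality is a formula. *)
Lemma finite_family_homogeneous I (x v : I -> M) :
  finite_set (range x) ->
  (forall n (phi : formula L 'I_n) (h : 'I_n -> I),
     sat (x \o h) phi <-> sat (v \o h) phi) ->
  exists2 s : M -> M, automorphism s & forall i, s (x i) = v i.
Proof.
move=> fx xv.
have xv_eq i j : x i = x j -> v i = v j.
  move=> xij; pose phi := @FEq L 'I_2 (TVar L ord0) (TVar L ord_max).
  pose h (l : 'I_2) := if l == ord0 then i else j.
  by have /= [+ _] := xv 2 phi h; apply.
have [f fxv] : exists f : M -> M, forall i, f (x i) = v i.
  have /choice[f Hf] : forall z, exists w, forall i, x i = z -> w = v i.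
    move=> z; case: (pselect (exists i, x i = z)) => [[i xi]|nz].
      by exists (v i) => j; rewrite -xi => /xv_eq ->.
    by exists z => i xi; case: nz; exists i.
  by exists f => i; exact: Hf.
have [||s [As sf]] := M_hom (A := range x) (f := f).
- exact/countable_smaller/finite_set_countable.
- move=> k a xa phi.
  have /choice[h ha] : forall i, exists j, x j = a i by move=> i; case: (xa i) => j; exists j.
  have -> : a = x \o h by apply: funext => i /=; rewrite ha.
  rewrite xv; suff -> : f \o (x \o h) = v \o h by [].
  by apply: funext => i /=; rewrite fxv.
- by exists s => // i; rewrite sf // ; exists i.
Qed.


(** * Invariant types as ultrafilters on self-maps *)

(** The formula phi, with variables placed by h, takes on the left side of [+]
points b of M, to be moved by s, and on the right side parameters from M. Thus
V gives every tuple b of M a limit type over M, namely all phi(x, e) such that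
phi(s b, e) holds for V-almost all s; the last field says that these types are
invariant under t. The limit types of all tuples are thereby coherent: the one
of a subtuple is the restriction. *)
Record invariant_ultrafilter (V : set_system (M -> M)) : Prop := {
  invariant_ultra : UltraFilter V;
  invariant_aut : V (@automorphism L M);
  invariant_shift : forall n (phi : formula L 'I_n) (h : 'I_n -> M + M) t,
    automorphism t ->
    V [set s : M -> M | sat (assign s id \o h) phi <-> sat (assign s t \o h) phi]
}.

(** On the points of X, s realizes over Y the limit type given by V. *)
Definition realizes (V : set_system (M -> M)) (s : M -> M) (X Y : set M) :=
  forall n (phi : formula L 'I_n) (h : 'I_n -> M + M),
    (forall i, match h i with inl x => X x | inr y => Y y end) ->
    (V [set r : M -> M | sat (assign r id \o h) phi] <-> sat (assign s id \o h) phi).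

Definition same_global_type (V : set_system (M -> M)) k (u w : 'I_k -> M) :=
  forall n (phi : formula L 'I_n) (h : 'I_n -> 'I_k + M),
    V [set s : M -> M | sat (assign (s \o u) id \o h) phi <->
               sat (assign (s \o w) id \o h) phi].

Lemma realizes_sub V s (X X' Y Y' : set M) :
  X `<=` X' -> Y `<=` Y' -> realizes V s X' Y' -> realizes V s X Y.
Proof.
move=> XX' YY' sXY n phi h hXY; apply: sXY => i.
by case: (h i) (hXY i) => [x /XX'|y /YY'].
Qed.

Lemma same_global_type_refl V k (u : 'I_k -> M) :
  Filter V -> same_global_type V u u.
Proof. by move=> FV n phi h; apply: filterE. Qed.

(** Saturation provides a realization of the limit type of an enumeration of X;
V concentrates on automorphisms, so this realization has the type of X over the
empty set and homogeneity turns it into an automorphism. *)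
Lemma realizes_exists V (X Y : set M) : invariant_ultrafilter V ->
  finite_set X -> finite_set Y ->
  exists2 s : M -> M, automorphism s & realizes V s X Y.
Proof.
move=> [VU Vaut _] /finite_set_enum[m [x ->]] fY.
have sY : smaller Y K by exact/countable_smaller/finite_set_countable.
have WU : UltraFilter (fmap (fun s : M -> M => s \o x) V) by exact: ultra_fmap.
have [v vW] := ultrafilter_realized WU sY.
have xv n (phi : formula L 'I_n) (h : 'I_n -> 'I_m) :
    sat (x \o h) phi <-> sat (v \o h) phi.
  have := vW (rename (inl \o h) phi); rewrite sat_rename => ->.
  have : V [set s : M -> M | sat (x \o h) phi <->
                    sat (assign (s \o x) (@set_val M Y)) (rename (inl \o h) phi)].
    apply: filterS Vaut => s As /=; rewrite sat_rename.
    by rewrite -(sat_automorphism _ _ As).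
  move=> VE; split=> [xphi|Vx].
    by apply: (filterS (F := V)) VE => s [+ _]; apply.
  have /(_ _)/filter_ex[s [[_ sphi] Vs]] := @filterI _ V _ _ _ VE Vx; exact: sphi.
have [s As sx] := finite_family_homogeneous (finite_set_range x) xv.
exists s => // n phi h hXY.
have /choice[g gh] : forall i, exists z : 'I_m + Y,
    forall r, assign (r \o x) val z = assign r id (h i).
  move=> i; case: (h i) (hXY i) => [_ [j _ <-]|y Yy]; first by exists (inl j).
  by exists (inr (exist _ y (mem_set Yy))).
have gE r : assign r id \o h = assign (r \o x) val \o g.
  by apply: funext => i; rewrite /= gh.
have -> : sat (assign s id \o h) phi <-> sat (assign v val) (rename g phi).
  rewrite sat_rename gE; suff -> : s \o x = v by [].
  exact: funext.
have FV : Filter V by typeclasses eauto.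
have E : V [set r : M -> M | sat (assign r id \o h) phi] <->
         V [set r : M -> M | sat (assign (r \o x) val) (rename g phi)].
  by apply: ultra_iff; apply: filterE => r /=; rewrite gE sat_rename.
by rewrite E vW.
Qed.

(** An invariant type has, up to conjugacy, only one realization over a set and
its conjugates. Here s u and s' w realize the same invariant type over Y and
over t Y, since u and w have the same limit type. *)
Lemma realizes_conjugate V k (u w : 'I_k -> M) s s' t (Y : set M) :
  invariant_ultrafilter V -> same_global_type V u w -> finite_set Y ->
  automorphism t -> realizes V s (range u) Y ->
  realizes V s' (range w) (t @` Y) ->
  exists r : M -> M, [/\ automorphism r, forall y, Y y -> r y = t y &
    forall i, r (s (u i)) = s' (w i)].
Proof.
move=> [VU Vaut Vinv] uw fY At su s'w.
pose x : 'I_k + Y -> M := assign (s \o u) val.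
pose v : 'I_k + Y -> M := assign (s' \o w) (t \o val).
have [||r Ar rx] := @finite_family_homogeneous _ x v; last first.
- exists r; split=> // [y Yy|i]; last exact: (rx (inl i)).
  exact: (rx (inr (exist _ y (mem_set Yy)))).
- move=> n phi h.
  pose g (z : 'I_n) : 'I_k + M :=
    match h z with inl j => inl j | inr y => inr (val y) end.
  (* loc q c places the variables of phi at the points q and the parameters c y. *)
  pose loc (q : 'I_k -> M) (c : M -> M) (z : 'I_n) : M + M :=
    match h z with inl j => inl (q j) | inr y => inr (c (val y)) end.
  have E (r : M -> M) q c : assign r c \o loc q id = assign (r \o q) (c \o val) \o h.
    by apply: funext => z; rewrite /loc /=; case: (h z).
  have E' r q : assign r id \o loc q id = assign (r \o q) id \o g.
    by apply: funext => z; rewrite /loc /g /=; case: (h z).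
  have Et r c : assign r id \o loc w c = assign r c \o loc w id.
    by apply: funext => z; rewrite /loc /=; case: (h z).
  rewrite -[x \o h](E s u id) -[v \o h](E s' w t) -Et.
  rewrite -su; last first.
    by move=> z; rewrite /loc; case: (h z) => [j|y]; [exists j|exact: set_valP].
  rewrite -s'w; last first.
    move=> z; rewrite /loc; case: (h z) => [j|y]; first by exists j.
    by exists (val y) => //; exact: set_valP.
  have FV : Filter V by typeclasses eauto.
  transitivity (V [set r : M -> M | sat (assign r id \o loc w id) phi]).
    by apply: ultra_iff; apply: filterS (uw _ phi g) => r /=; rewrite !E'.
  by apply: ultra_iff; apply: filterS (Vinv _ phi (loc w id) t At) => r; rewrite /= Et.
- apply: (@sub_finite_set _ _ (range (s \o u) `|` Y)).
    by move=> _ [[i|y] _ <-]; [left; exists i|right; exact: set_valP].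
  by rewrite finite_setU; split=> //; exact: finite_set_range.
Qed.


Lemma same_type_conjugate k (a b : 'I_k -> M) : same_type a b ->
  exists2 s : M -> M, automorphism s & s \o a = b.
Proof.
move=> ab; have [n phi h|s As sab] :=
    finite_family_homogeneous (v := b) (finite_set_range a).
  by have := ab (rename h phi); rewrite !sat_rename.
by exists s => //; apply: funext => i; exact: sab.
Qed.

Lemma automorphism_same_type (s : M -> M) k (a : 'I_k -> M) :
  automorphism s -> same_type (s \o a) a.
Proof. by move=> As phi; exact: sat_automorphism. Qed.

Lemma realizes_conjugate_set V (X Y : set M) s s' t :
  invariant_ultrafilter V -> finite_set X -> finite_set Y ->
  automorphism t -> realizes V s X Y -> realizes V s' X (t @` Y) ->
  exists r : M -> M, [/\ automorphism r, forall y, Y y -> r y = t y &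
    forall x, X x -> r (s x) = s' x].
Proof.
move=> Vinv /finite_set_enum[k [u ->]] fY At su s'u.
have [VU _ _] := Vinv; have FV : Filter V by typeclasses eauto.
have [r [Ar rt rs]] :=
  realizes_conjugate Vinv (same_global_type_refl u FV) fY At su s'u.
by exists r; split=> // _ [i _ <-].
Qed.

(** * Morley sequences and freeness *)

Fixpoint prefix_union (g : nat -> M -> M) (X : set M) (l : nat) : set M :=
  if l is l'.+1 then prefix_union g X l' `|` g l' @` X else set0.

Lemma prefix_union_finite g X l : finite_set X -> finite_set (prefix_union g X l).
Proof.
move=> fX; elim: l => [|l IH] /=; first exact: finite_set0.
by rewrite finite_setU; split=> //; exact: finite_image.
Qed.

Lemma prefix_union_sub g X i l : i < l -> g i @` X `<=` prefix_union g X l.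
Proof.
elim: l => // l IH; rewrite ltnS leq_eqVlt => /predU1P[->|/IH il] x gx.
  by right.
by left; exact: il.
Qed.

Definition morley (V : set_system (M -> M)) (X : set M) (g : nat -> M -> M) :=
  forall l, automorphism (g l) /\ realizes V (g l) X (prefix_union g X l).

Lemma morley_exists V X : invariant_ultrafilter V -> finite_set X ->
  exists g, morley V X g.
Proof.
move=> Vinv fX.
have /choice[F HF] : forall Y, exists s : M -> M, finite_set Y ->
    automorphism s /\ realizes V s X Y.
  move=> Y; case: (pselect (finite_set Y)) => [fY|nfY]; last by exists id.
  by have [s As sXY] := realizes_exists Vinv fX fY; exists s.
pose Y := fix Y l := if l is l'.+1 then Y l' `|` F (Y l') @` X else set0.
have YE l : prefix_union (fun l => F (Y l)) X l = Y l by elim: l => //= l ->.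
exists (fun l => F (Y l)) => l; rewrite YE; apply: HF.
by rewrite -YE; exact: prefix_union_finite.
Qed.

(** Z is obtained by successively realizing invariant types over X and what
precedes: the type of Z over X extends to an iterated product of invariant
types. Products are needed since different blocks of Z may come from different
ultrafilters. *)
Inductive free (X : set M) : set M -> Prop :=
| free0 : free X set0
| free_extend V s Z Z0 : free X Z -> invariant_ultrafilter V ->
    automorphism s -> finite_set Z0 -> realizes V s Z0 (X `|` Z) ->
    free X (Z `|` s @` Z0).

Lemma free_finite X Z : free X Z -> finite_set Z.
Proof.
elim=> [|V s Z' Z0 _ fZ _ _ fZ0 _]; first exact: finite_set0.
by rewrite finite_setU; split=> //; exact: finite_image.
Qed.

Lemma free_sub X X' Z : X `<=` X' -> free X' Z -> free X Z.
Proof.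
move=> XX'; elim=> [|V s Z' Z0 _ IH Vinv As fZ0 sZ0]; first exact: free0.
apply: free_extend IH Vinv As fZ0 _; apply: realizes_sub sZ0 => //.
exact: setSU.
Qed.

Lemma free_cat X Y Z : free X Y -> free (X `|` Y) Z -> free X (Y `|` Z).
Proof.
move=> XY; elim=> [|V s Z' Z0 _ IH Vinv As fZ0 sZ0]; first by rewrite setU0.
by rewrite setUA; apply: free_extend Vinv As fZ0 _ => //; rewrite setUA.
Qed.

(** A product of invariant types can be realized over any finite set Y, and up
to conjugacy the result depends only on the copy of X in Y over which it is
seen: the copy of Z by th stands to each conjugate g X inside Y as Z to X. The
hypothesis on g0 provides one such conjugate; its extension to Z is th. *)
Lemma free_move X Z Y g0 : free X Z -> finite_set X -> finite_set Y ->
  automorphism g0 -> g0 @` X `<=` Y ->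
  exists th : M -> M, [/\ automorphism th, free Y (th @` Z) &
    forall g, automorphism g -> g @` X `<=` Y ->
      exists r : M -> M, [/\ automorphism r, forall x, X x -> r x = g x &
        forall z, Z z -> r z = th z]].
Proof.
move=> XZ fX fY Ag0 g0Y; elim: XZ => [|V s Z' Z0 XZ [th [Ath YZ IH]] Vinv As fZ0 sZ0].
  exists id; split; first exact: automorphism_id.
    by rewrite image_set0; exact: free0.
  by move=> g Ag _; exists g.
have fZ := free_finite XZ.
have [s' As' s'Z0] : exists2 s' : M -> M, automorphism s' &
    realizes V s' Z0 (Y `|` th @` Z').
  apply: realizes_exists => //; rewrite finite_setU; split=> //.
  exact: finite_image.
have extend g : automorphism g -> g @` X `<=` Y -> exists r : M -> M,
    [/\ automorphism r, forall x, X x -> r x = g x,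
        forall z, Z' z -> r z = th z & forall z, Z0 z -> r (s z) = s' z].
  move=> Ag gY; have [r [Ar rX rZ]] := IH g Ag gY.
  have [||r' [Ar' r'XZ r'Z0]] := realizes_conjugate_set Vinv fZ0 _ Ar sZ0 (s' := s').
  - by rewrite finite_setU.
  - apply: realizes_sub s'Z0 => // _ [x [Xx|Zx] <-].
      by left; rewrite rX //; apply: gY; exists x.
    by right; rewrite rZ //; exists x.
  - exists r'; split=> // x xZ; rewrite r'XZ; [exact: rX|by left|exact: rZ|by right].
have [r [Ar rX rZ rZ0]] := extend g0 Ag0 g0Y.
exists r; split=> // [|g Ag gY].
  suff -> : r @` (Z' `|` s @` Z0) = th @` Z' `|` s' @` Z0 by exact: free_extend s'Z0.
  rewrite image_setU; congr setU; first exact: eq_imagel.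
  by rewrite image_comp; apply: eq_imagel => z /rZ0.
have [r' [Ar' r'X r'Z r'Z0]] := extend g Ag gY; exists r'; split=> // z.
case=> [Zz|[z0 Zz <-]]; first by rewrite r'Z ?rZ.
by rewrite r'Z0 ?rZ0.
Qed.


(** * Inseparable pairs *)

(** The limit type of b for the image ultrafilter is that of t b for V. *)
Lemma invariant_fmap V (t : M -> M) : invariant_ultrafilter V ->
  automorphism t -> invariant_ultrafilter (fmap (fun s : M -> M => s \o t) V).
Proof.
move=> [VU Vaut Vinv] At; split; first exact: ultra_fmap.
  by apply: (filterS (F := V)) Vaut => s As; exact: automorphism_comp.
move=> n phi h c Ac.
pose g z := if h z is inl x then inl (t x) else h z.
have gE (s d : M -> M) : assign (s \o t) d \o h = assign s d \o g.
  by apply: funext => z; rewrite /g /=; case: (h z).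
by apply: (filterS (F := V)) (Vinv _ phi g c Ac) => s /=; rewrite -!gE.
Qed.

Definition ultralimit (W : set_system nat) (V : nat -> set_system (M -> M)) :
    set_system (M -> M) := [set S | W [set j | V j S]].

Lemma invariant_ultralimit W V : UltraFilter W ->
  (forall j, invariant_ultrafilter (V j)) ->
  invariant_ultrafilter (ultralimit W V).
Proof.
move=> WU Vinv.
have VU j : UltraFilter (V j) by case: (Vinv j).
split=> [||n phi h t At].
- apply: decides_ultra => [|A].
    split=> [V0|].
      apply: (@filter_not_empty _ W); apply: (filterS (F := W)) V0 => j /=.
      exact: filter_not_empty.
    split=> [|A B VA VB|A B AB VA].
    + by apply: (filterE (F := W)) => j; exact: filterT.
    + by apply: (filterS2 (F := W)) VA VB => j /= VjA VjB; exact: filterI.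
    + by apply: (filterS (F := W)) VA => j /= VjA; exact: filterS AB VjA.
  have [WA|WnA] := in_ultra_setVsetC [set j | V j A] WU; first by left.
  by right; apply: (filterS (F := W)) WnA => j /= nA; apply/ultra_setC.
- by apply: (filterE (F := W)) => j; case: (Vinv j).
- by apply: (filterE (F := W)) => j; case: (Vinv j) => _ _; apply.
Qed.

(** For a Morley sequence of copies of both tuples, built with the ultrafilter V,
copies of one tuple may then be replaced by copies of the other. *)
Definition inseparable k (u w : 'I_k -> M) :=
  exists2 V, invariant_ultrafilter V & same_global_type V u w.

Lemma inseparable_refl V k (u : 'I_k -> M) :
  invariant_ultrafilter V -> inseparable u u.
Proof.
by move=> Vinv; have [VU _ _] := Vinv; exists V => //; exact: same_global_type_refl.
Qed.

(** Continue (u, s a) to a Morley sequence (g i a). Any pair of its members with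
i < j is the image of (u, s a) under an automorphism r (i, j), by uniqueness of
realizations of invariant types. Take the iterated limit, first over j and then
over i, along a nonprincipal ultrafilter on nat, of the images of V under these
r (i, j): for it the limit types of u and of s a are both the limit of the
limit types of the g i a. *)
Lemma morley_inseparable V k (a u : 'I_k -> M) s :
  invariant_ultrafilter V -> same_type u a ->
  realizes V s (range a) (range u) -> inseparable u (s \o a).
Proof.
move=> Vinv ua sau; have [VU Vaut Vshift] := Vinv.
have fa := finite_set_range a; have fu := finite_set_range u.
have [c Ac cu] := same_type_conjugate ua.
have [g gM] := morley_exists Vinv fa.
have Ag j : automorphism (g j) by case: (gM j).
have r_ex i j : exists r : M -> M, automorphism r /\
    (i < j -> r \o u = g i \o a /\ r \o (s \o a) = g j \o a).
  case: (ltnP i j) => [ij|ji]; last by exists id; split=> //; exact: automorphism_id.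
  have [|r [Ar rgc rs]] := realizes_conjugate_set Vinv fa fu
      (automorphism_comp (Ag i) Ac) sau (s' := g j).
    apply: realizes_sub (gM j).2 => // _ [_ [x _ <-] <-].
    apply: (prefix_union_sub ij); exists (a x); first by exists x.
    by rewrite /= -cu.
  exists r; split=> // _; split; apply: funext => x /=.
    by rewrite rgc; [rewrite /= -cu|exists x].
  by rewrite rs //; exists x.
have /choice[r r_all] : forall ij : nat * nat, exists r : M -> M, automorphism r /\
    (ij.1 < ij.2 -> r \o u = g ij.1 \o a /\ r \o (s \o a) = g ij.2 \o a).
  by move=> [i j]; exact: r_ex.
have [W [WU W_infty]] := ultraFilterLemma eventually_filter.
have W_gt i : W [set j | i < j] by apply: W_infty; exists i.+1.
exists (ultralimit W (fun i => ultralimit W (fun j =>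
          fmap (fun s : M -> M => s \o r (i, j)) V))).
  apply: invariant_ultralimit => // i; apply: invariant_ultralimit => // j.
  by apply: invariant_fmap => //; case: (r_all (i, j)).
move=> n phi h.
pose P i := [set t : M -> M | sat (assign (t \o (g i \o a)) id \o h) phi].
(* Along W, the formula eventually holds in the limit types of all the g i a, or
   eventually fails in all of them. *)
suff [b Wb] : exists b : bool, W [set i | V (if b then P i else ~` P i)].
  apply: filterS (Wb) => i Vi; apply: filterS2 Wb (W_gt i) => j Vj ij.
  have [_ /(_ ij)[ru rw]] := r_all (i, j).
  apply: (filterS2 (F := V)) Vi Vj => t Pi Pj.
  have Eu : (t \o r (i, j)) \o u = t \o (g i \o a) by rewrite -ru.
  have Ew : (t \o r (i, j)) \o (s \o a) = t \o (g j \o a) by rewrite -rw.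
  rewrite /= Eu Ew; move: Pi Pj; rewrite /P.
  by case: b => /= Pi Pj; split.
have [WP|WnP] := in_ultra_setVsetC [set i | V (P i)] WU; first by exists true.
by exists false; apply: filterS WnP => i /= nP; apply/ultra_setC.
Qed.


(** * Broom argument *)

(** The only property of a color that is needed: along a Morley sequence it
cannot separate all copies of an inseparable pair, and how far one has to look
does not depend on the automorphism c applied to the sequence. *)
Definition tame k (P : ('I_k -> M) -> Prop) :=
  forall V (u w : 'I_k -> M) X g, invariant_ultrafilter V ->
    finite_set X -> same_global_type V u w -> range u `<=` X ->
    range w `<=` X ->
    morley V X g ->
  exists N, forall c, automorphism c ->
    exists2 l, l < N & (P (c \o g l \o u) <-> P (c \o g l \o w)).

(** R is a condition on the values on X of an automorphism. It is solvable if it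
can be achieved on every conjugate g X, by an automorphism with prescribed
values on any given set free over g X. Quantifying over g allows to use R on
all copies of X in a Morley sequence. *)
Definition solvable (X : set M) (R : (M -> M) -> Prop) :=
  (forall s t, (forall x, X x -> s x = t x) -> R s -> R t) /\
  (forall g Z t, automorphism g -> free (g @` X) Z -> automorphism t ->
    exists s : M -> M, [/\ automorphism s, forall z, Z z -> s z = t z & R (s \o g)]).

(** The copies are treated from the last one to the first one: a copy already
treated joins the set Z on which values are prescribed, which remains free over
the earlier copies. *)
Lemma solvable_morley V (X : set M) g (R : (M -> M) -> Prop) l Z t :
  invariant_ultrafilter V -> finite_set X -> morley V X g -> solvable X R ->
  free (prefix_union g X l) Z -> automorphism t ->
  exists s : M -> M, [/\ automorphism s, forall z, Z z -> s z = t z &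
    forall i, i < l -> R (s \o g i)].
Proof.
move=> Vinv fX gM [Rloc Rsol].
elim: l Z t => [|l IH] Z t XZ At; first by exists t.
have [Agl gl] := gM l.
have [s [As sZ Rs]] := Rsol (g l) Z t Agl (free_sub (@subsetUr _ _ _) XZ) At.
have Xgl : free (prefix_union g X l) (g l @` X).
  rewrite -(set0U (g l @` X)); apply: free_extend Vinv Agl fX _; first exact: free0.
  by rewrite setU0.
have [s' [As' s'Z Rs']] := IH _ s (free_cat Xgl XZ) As.
exists s'; split=> // [z Zz|i]; first by rewrite s'Z ?sZ //; right.
rewrite ltnS leq_eqVlt => /predU1P[->|/Rs'//].
by apply: Rloc Rs => x Xx /=; rewrite s'Z //; left; exists x.
Qed.

(** In a Morley sequence of copies of X for an ultrafilter witnessing that u and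
w are inseparable, solve R on all copies; tameness provides a copy on which P
does not separate the images of u and w. As the set Z can be moved to be free
over the whole sequence and in the same position to every copy, this one copy
can be brought back to X. *)
Lemma solvable_pair (X : set M) (R : (M -> M) -> Prop) k (u w : 'I_k -> M) P :
  finite_set X -> range u `<=` X -> range w `<=` X -> inseparable u w ->
  tame P -> solvable X R ->
  solvable X (fun s => R s /\ (P (s \o u) <-> P (s \o w))).
Proof.
move=> fX uX wX [V Vinv uw] Ptame RX; have [Rloc _] := RX.
have on_tuple (s t : M -> M) (q : 'I_k -> M) : range q `<=` X ->
    (forall x, X x -> s x = t x) -> s \o q = t \o q.
  by move=> qX st; apply: funext => i; apply: st; apply: qX; exists i.
split=> [s t st [Rs Ps]|b Z t Ab bXZ At].
  split; first exact: Rloc Rs.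
  by rewrite -(on_tuple s t u) // -(on_tuple s t w).
have [g gM] := morley_exists Vinv fX.
have Ag l : automorphism (g l) by case: (gM l).
have [N gN] := Ptame V u w X g Vinv fX uw uX wX gM.
have [b' [Ab' bK Kb]] := automorphism_inv Ab.
have gbX l : (g l \o b') @` (b @` X) = g l @` X.
  by rewrite image_comp; apply: eq_imagel => x _ /=; rewrite bK.
have Agb l : automorphism (g l \o b') by exact: automorphism_comp.
have gY l : l < N.+1 -> (g l \o b') @` (b @` X) `<=` prefix_union g X N.+1.
  by move=> lN; rewrite gbX; exact: prefix_union_sub.
have [th [Ath YZ th_ext]] := free_move bXZ (finite_image b fX)
  (prefix_union_finite g N.+1 fX) (Agb 0) (gY 0 isT).
have [th' [Ath' thK Kth]] := automorphism_inv Ath.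
have [c [Ac cZ Rc]] := solvable_morley Vinv fX gM RX YZ (automorphism_comp At Ath').
have [l lN Pl] := gN c Ac.
have [r [Ar rX rZ]] := th_ext (g l \o b') (Agb l) (gY l (ltnW lN)).
have crb x : X x -> (c \o g l) x = ((c \o r) \o b) x.
  by move=> Xx /=; rewrite rX /= ?bK //; exists x.
exists (c \o r); split; first exact: automorphism_comp.
- move=> z Zz; rewrite /= rZ // cZ /= ?thK //; by exists z.
- split; first by apply: Rloc (Rc l (ltnW lN)) => x Xx; rewrite crb.
  by rewrite -!(on_tuple _ _ _ _ crb).
Qed.

Lemma solvable_all (X : set M) k (J : eqType) (js : seq J) (u w : J -> 'I_k -> M)
    (P : J -> ('I_k -> M) -> Prop) :
  finite_set X ->
  (forall j, [/\ range (u j) `<=` X, range (w j) `<=` X, inseparable (u j) (w j) &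
                 tame (P j)]) ->
  solvable X (fun s => forall j, j \in js -> (P j (s \o u j) <-> P j (s \o w j))).
Proof.
move=> fX Puw; elim: js => [|j js IH].
  by split=> // g Z t Ag _ At; exists t.
have [uX wX uw Pj] := Puw j.
have [loc sol] := solvable_pair fX uX wX uw Pj IH.
have E s : (forall i, i \in j :: js -> (P i (s \o u i) <-> P i (s \o w i))) <->
    (forall i, i \in js -> (P i (s \o u i) <-> P i (s \o w i))) /\
    (P j (s \o u j) <-> P j (s \o w j)).
  split=> [H|[H Hj] i]; last by rewrite inE => /predU1P[->|/H].
  by split=> [i ijs|]; apply: H; rewrite inE ?ijs ?orbT ?eqxx.
split=> [s t st /E Rs|g Z t Ag gXZ At]; first by apply/E; exact: loc Rs.
by have [s [As sZ /E Rs]] := sol g Z t Ag gXZ At; exists s.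
Qed.


Lemma sat_subst_left k m (x : 'I_k -> M) (y : 'I_m -> M)
    (phi : formula L ('I_k + 'I_m)) :
  sat (assign y id) (subst_left x phi) <-> sat (assign x y) phi.
Proof.
rewrite sat_rename.
suff -> : assign y id \o assign (fun j => inr (x j)) (fun j => inl j) = assign x y by [].
by apply: funext => -[].
Qed.

(** * NIP *)

(** Since u and w have the same limit type, choosing one of the two at each
place of a Morley sequence does not change the type of the sequence. *)
Lemma morley_choice V k (u w : 'I_k -> M) X g (e : nat -> 'I_k -> M) l :
  invariant_ultrafilter V -> same_global_type V u w -> finite_set X ->
  range u `<=` X -> range w `<=` X -> morley V X g ->
  (forall i, e i = u \/ e i = w) ->
  exists2 r : M -> M, automorphism r & forall i, i < l -> r \o (g i \o u) = g i \o e i.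
Proof.
move=> Vinv uw fX uX wX gM euw; have [VU _ _] := Vinv.
have pre q i : range q `<=` X -> prefix_union g (range q) i `<=` prefix_union g X i.
  move=> qX; elim: i => //= i IH; apply: setUSS => //; exact: image_subset.
(* The induction needs to know where r sends the earlier first entries, in order
   to compare realizations over them and over their images. *)
suff [r [Ar rge _]] : exists r : M -> M, [/\ automorphism r,
    forall i, i < l -> r \o (g i \o u) = g i \o e i &
    r @` prefix_union g (range u) l `<=` prefix_union g X l] by exists r.
elim: l => [|l [r [Ar rge rX]]].
  by exists id; split=> //; [exact: automorphism_id|rewrite image_set0].
have eX : range (e l) `<=` X by case: (euw l) => ->.
have ue : same_global_type V u (e l).
  by case: (euw l) => -> //; exact: same_global_type_refl.
have [Ag gl] := gM l.
have fpre : finite_set (prefix_union g (range u) l).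
  exact/prefix_union_finite/finite_set_range.
have glu : realizes V (g l) (range u) (prefix_union g (range u) l).
  by apply: realizes_sub gl => //; exact: pre.
have [r' [Ar' r'r r'l]] := realizes_conjugate Vinv ue fpre Ar glu (realizes_sub eX rX gl).
exists r'; split=> // [i|_ [x + <-]].
  rewrite ltnS leq_eqVlt => /predU1P[->|il]; first by apply: funext.
  rewrite -rge //; apply: funext => x /=; apply: r'r.
  by apply: (prefix_union_sub il); exists (u x).
case=> [xl|[_ [y _ <-] <-]]; first by left; rewrite r'r //; apply: rX; exists x.
by right; rewrite r'l; exists (e l y) => //; apply: eX; exists y.
Qed.

(** Otherwise phi, evaluated at a parameter realizing p, separates all pairs in
arbitrarily long initial segments of a Morley sequence. Choosing in every pair
the entry with a given value, and moving these entries back to first entries,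
every finite pattern of phi is realized along the first entries (a l), and
saturation over these countably many parameters gives all infinite patterns. *)
Lemma NIP_tame (T : set (sentence L)) k m (phi : formula L ('I_k + 'I_m)) p :
  model T M -> NIP T -> complete_type id p ->
  tame (fun x : 'I_k -> M => p (subst_left x phi)).
Proof.
move=> TM TNIP [p_fin p_dec] V u w X g Vinv fX uw uX wX gM.
apply: contrapT => /forallNP noN; apply: (TNIP k m phi).
have Ag l : automorphism (g l) by case: (gM l).
pose a l := g l \o u.
have finite_pattern (S : set nat) N :
    exists y : 'I_m -> M, forall l, l < N -> (sat (assign (a l) y) phi <-> S l).
  have /existsNP[c /not_implyP[Ac /forall2NP alt]] := noN N.
  have /choice[e He] : forall l, exists x, (x = u \/ x = w) /\
      (l < N -> (p (subst_left (c \o g l \o x) phi) <-> S l)).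
    move=> l; have [] := alt l; first by move=> nlN; exists u; split; [left|].
    case: (pselect (S l)) => Sl;
    case: (pselect (p (subst_left (c \o g l \o u) phi))) => pu uwl;
    case: (pselect (p (subst_left (c \o g l \o w) phi))) => pw;
      by [exfalso; apply: uwl | exists u; split=> //; left | exists w; split=> //; right].
  have [r Ar re] : exists2 r : M -> M, automorphism r &
      forall i, i < N -> r \o (g i \o u) = g i \o e i.
    by apply: (morley_choice (V := V) (w := w) (X := X)) => // i; case: (He i).
  (* p contains all the psi l, so some y in M satisfies the first N of them. *)
  pose psi l := if `[< S l >] then subst_left (c \o g l \o e l) phi
                else FNot (subst_left (c \o g l \o e l) phi).
  have [|_ [l lN <-]|y Hy] := p_fin (psi @` `I_N).
  - exact: finite_image.
  - have [_ /(_ lN) pS] := He l; rewrite /psi; case: asboolP => [/pS //|nS].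
    by case: (p_dec (subst_left (c \o g l \o e l) phi)) => // /pS.
  have Acr := automorphism_comp Ac Ar.
  have [d [Ad _ dK]] := automorphism_inv Acr.
  exists (d \o y) => l lN; rewrite -(sat_automorphism _ _ Acr).
  have -> : (c \o r) \o assign (a l) (d \o y) = assign (c \o g l \o e l) y.
    apply: funext => -[j|j]; last exact: dK.
    by rewrite /= -[r _]/((r \o (g l \o u)) j) re.
  have : sat (assign y id) (psi l) by apply: Hy; exists l.
  by rewrite -sat_subst_left /psi; case: asboolP => Sl Hl; split.
have pattern (S : set nat) :
    exists y : 'I_m -> M, forall l, sat (assign (a l) y) phi <-> S l.
  pose F := [set A : set ('I_m -> M) | exists N, forall y : 'I_m -> M,
    (forall l, l < N -> (sat (assign (a l) y) phi <-> S l)) -> A y].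
  have FF : ProperFilter F.
    split=> [[N F0]|]; first by have [y /F0] := finite_pattern S N.
    split=> [|A B [N1 A1] [N2 B2]|A B AB [N AN]]; first by exists 0.
      exists (maxn N1 N2) => y Hy; split; [apply: A1|apply: B2] => l lN;
      by apply: Hy; rewrite leq_max lN ?orbT.
    by exists N => y /AN /AB.
  have [W [WU FW]] := ultraFilterLemma FF.
  pose D : set M := \bigcup_l range (a l).
  have cD : countable D.
    apply: bigcup_countable => // l _.
    exact/finite_set_countable/finite_set_range.
  have [y yW] := ultrafilter_realized WU (countable_smaller cD).
  exists y => l.
  have aD j : a l j \in D by apply: mem_set; exists l => //; exists j.
  pose h := assign (fun j => inr (exist _ (a l j) (aD j)) : 'I_m + D) inl.
  have E z : assign z val \o h = assign (a l) z by apply: funext => -[].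
  have -> : sat (assign (a l) y) phi <-> sat (assign y val) (rename h phi).
    by rewrite sat_rename E.
  rewrite yW.
  have Wl : W [set z | sat (assign (a l) z) phi <-> S l].
    by apply: FW; exists l.+1 => z; apply.
  split=> [Wphi|Sl].
    have WPF : ProperFilter W by typeclasses eauto.
    have [z [/= + zS]] := @filter_ex _ W WPF _ (filterI Wphi Wl).
    by rewrite sat_rename E => /zS.
  by apply: filterS Wl => z /= zS; rewrite sat_rename E; exact/zS.
have /choice[b Hb] := pattern.
by exists M; split=> //; exists a, b => i S; exact: Hb.
Qed.


(** * From DEERP to invariant types *)

(** A formula with variables placed in M + M and an automorphism: the data of one
instance of invariance. *)
Record shift := Shift {
  shift_arity : nat;
  shift_formula : formula L 'I_shift_arity;
  shift_vars : 'I_shift_arity -> M + M;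
  shift_aut : M -> M
}.

Definition respects (x : shift) (s : M -> M) :=
  sat (assign s id \o @shift_vars x) (shift_formula x) <->
  sat (assign s (shift_aut x) \o @shift_vars x) (shift_formula x).

(** Let e enumerate the parameters of all the formulas involved. Color the
conjugates y of e by the truth values of the formulas with y in place of e and
the moved points kept as parameters. A homogeneous conjugate, under s, of a set
containing e and all its translates says that these formulas do not distinguish
s e from s (t e); the inverse of s is as required. *)
Lemma DEERP_respects N (x : 'I_N -> shift) : DEERP M ->
  (forall i, automorphism (shift_aut (x i))) ->
  exists2 s : M -> M, automorphism s & forall i, respects (x i) s.
Proof.
move=> deerp Ax; have [pt] := carrier_inhabited M.
have [E fE Ex] : exists2 E : set M, finite_set E &
    forall i j e, @shift_vars (x i) j = inr e -> E e.
  apply: finite_common_bound => [i|i A B AB HA j e /HA /AB//].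
  exists (range (fun j => if @shift_vars (x i) j is inr e then e else pt)).
    exact: finite_set_range.
  by move=> j e je; exists j => //; rewrite je.
have [k [e Ee]] := finite_set_enum fE.
have g_ex : forall i, exists g : 'I_(shift_arity (x i)) -> 'I_k + M,
    forall f : M -> M, assign (f \o e) id \o g = assign id f \o @shift_vars (x i).
  move=> i; have /choice[g Hg] : forall j, exists z : 'I_k + M, forall f : M -> M,
      assign (f \o e) id z = assign id f (@shift_vars (x i) j).
    move=> j; case E1: (@shift_vars (x i) j) => [b|b]; first by exists (inr b).
    have := Ex i j b E1; rewrite Ee => -[l _ <-].
    by exists (inl l).
  by exists g => f; apply: funext => j; exact: Hg.
pose g i := projT1 (cid (g_ex i)).
have gx i : forall f : M -> M,
    assign (f \o e) id \o g i = assign id f \o @shift_vars (x i) := projT2 (cid (g_ex i)).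
pose phi i := rename (g i) (shift_formula (x i)).
pose c : coloring M k N := fun y => [ffun i => `[< sat (assign y id) (phi i) >]].
pose B := range e `|` \bigcup_(i in [set: 'I_N]) range (shift_aut (x i) \o e).
have [|i|| B' [[s [As ->]] [col cB]]] := deerp B k e N c.
- rewrite finite_setU; split; first exact: finite_set_range.
  by apply: bigcup_finite => [|i _]; [exact: finite_finset|exact: finite_set_range].
- by left; exists i.
- exists phi => y _ i; rewrite /c ffunE /=.
  by split=> H; [exact/asboolP|apply/asboolPn].
have c_col f : automorphism f -> (forall j, B (f (e j))) -> c (s \o f \o e) = col.
  move=> Af Bf; suff : [set col] (c (s \o f \o e)) by [].
  rewrite -cB; exists (s \o f \o e) => //; split=> [j|]; first by exists (f (e j)).
  exact: automorphism_same_type (automorphism_comp As Af).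
have [r [Ar sr rs]] := automorphism_inv As.
exists r => // i.
have : c (s \o id \o e) i = c (s \o shift_aut (x i) \o e) i.
  rewrite !c_col //; first by move=> j; right; exists i => //; exists j.
    exact: automorphism_id.
  by move=> j; left; exists j.
rewrite /c /phi !ffunE => eq_c; have := asbool_eq_equiv eq_c; rewrite !sat_rename !gx.
rewrite -(sat_automorphism (assign id (s \o id) \o _) _ Ar).
rewrite -(sat_automorphism (assign id (s \o shift_aut (x i)) \o _) _ Ar).
have rE f : r \o (assign id (s \o f) \o @shift_vars (x i)) =
            assign r f \o @shift_vars (x i).
  by apply: funext => j /=; case: (@shift_vars (x i) j) => //= b; rewrite sr.
by rewrite !rE.
Qed.

(** Compactness: the conditions defining an invariant ultrafilter have the
finite intersection property by the previous lemma. *)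
Lemma DEERP_invariant_ultrafilter : DEERP M -> exists V, invariant_ultrafilter V.
Proof.
move=> deerp.
pose F := [set S : set (M -> M) | exists2 D : set shift, finite_set D /\
    (forall x, D x -> automorphism (shift_aut x)) &
    forall s, automorphism s -> (forall x, D x -> respects x s) -> S s].
have FF : ProperFilter F.
  split=> [[D [fD AD] F0]|].
    have [N [x Dx]] := finite_set_enum fD.
    have [i|s As xs] := DEERP_respects (x := x) deerp.
      by apply: AD; rewrite Dx; exists i.
    by apply: (F0 s As) => y; rewrite Dx => -[i _ <-].
  split=> [|A B [D [fD AD] DA] [D' [fD' AD'] D'B]|A B AB [D HD DA]].
  - by exists set0; split=> //; exact: finite_set0.
  - exists (D `|` D'); first by rewrite finite_setU; split=> // x [/AD|/AD'].
    by move=> s As xs; split; [apply: DA|apply: D'B] => // x Dx; apply: xs; [left|right].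
  - by exists D => // s As /(DA s As)/AB.
have [V [VU FV]] := ultraFilterLemma FF.
exists V; split=> //.
  by apply: FV; exists set0 => //; split=> //; exact: finite_set0.
move=> n phi h t At; apply: FV; exists [set Shift phi h t].
  by split=> [|x ->//]; exact: finite_set1.
by move=> s _ /(_ _ erefl).
Qed.

(** * The two implications *)

(** The tuples from B are indexed by finite functions into an enumeration of B,
and the pairs (tuple, color) are treated at once by [solvable_all]; each copy
of a in B is compared with the single tuple s a, which realizes the limit type
of a over B. *)
Lemma DEERP_EDEERP (T : set (sentence L)) : model T M -> NIP T -> DEERP M -> EDEERP M.
Proof.
move=> TM TNIP deerp B k a n c fB aB [m [phi [p [p_type cp]]]].
have [V Vinv] := DEERP_invariant_ultrafilter deerp.
have [s As sB] := realizes_exists Vinv (finite_set_range a) fB.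
have [N [x Bx]] := finite_set_enum fB.
pose u (j : {ffun 'I_k -> 'I_N} * 'I_n) :=
  if `[< same_type (x \o j.1) a >] then x \o j.1 else s \o a.
pose X := B `|` range (s \o a).
have fX : finite_set X by rewrite finite_setU; split=> //; exact: finite_set_range.
have saX : range (s \o a) `<=` X by exact: subsetUr.
have xB (f : {ffun 'I_k -> 'I_N}) : range (x \o f) `<=` B.
  by rewrite Bx => _ [i _ <-]; exists (f i).
have [|_ sol] := @solvable_all X k _ (enum {: {ffun 'I_k -> 'I_N} * 'I_n}) u
  (fun=> s \o a) (fun j y => p j.2 (subst_left y (phi j.2))) fX.
  move=> j; split=> //; last exact: NIP_tame TM TNIP (p_type _).
    by rewrite /u; case: asboolP => // _ y /xB; left.
  rewrite /u; case: asboolP => [xa|_]; last exact: inseparable_refl Vinv.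
  apply: (morley_inseparable Vinv xa); apply: realizes_sub sB => //.
have [t [At _ pt]] := sol id set0 id (@automorphism_id M) (free0 _) (@automorphism_id M).
exists (t @` B); split; first by exists t.
exists (c (t \o (s \o a))).
have Ats := automorphism_comp At As.
have c_const b : (forall i, B (b i)) -> same_type b a -> c (t \o b) = c (t \o (s \o a)).
  move=> bB ba; apply/ffunP => i.
  have /choice[f xf] : forall j, exists l, x l = b j.
    by move=> j; have := bB j; rewrite Bx => -[l _ <-]; exists l.
  have bE : x \o [ffun j => f j] = b by apply: funext => j /=; rewrite ffunE xf.
  have := pt ([ffun j => f j], i) (mem_enum _ _); rewrite /u /= bE.
  case: asboolP => // _ p_iff.
  have [tb1 tb0] : (p i (subst_left (t \o b) (phi i)) -> c (t \o b) i = true) /\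
      (p i (FNot (subst_left (t \o b) (phi i))) -> c (t \o b) i = false).
    by apply: cp; split=> // psi; rewrite -ba; exact: automorphism_same_type.
  have [ts1 ts0] : (p i (subst_left (t \o (s \o a)) (phi i)) -> c (t \o (s \o a)) i = true) /\
      (p i (FNot (subst_left (t \o (s \o a)) (phi i))) -> c (t \o (s \o a)) i = false).
    by apply: cp; split=> //; exact: (automorphism_same_type _ Ats).
  case: (pselect (p i (subst_left (t \o b) (phi i)))) => [pb|npb].
    by rewrite tb1 // ts1 //; exact/p_iff.
  have np_FNot y : ~ p i y -> p i (FNot y) by case: (p_type i) => _ /(_ y)[].
  by rewrite tb0 ?ts0 //; apply: np_FNot => // /p_iff.
apply/seteqP; split=> [_ [a' [a'B a'a] <-]|_ ->].
  have [t' [At' tK t'K]] := automorphism_inv At.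
  have a'E : t \o (t' \o a') = a' by apply: funext => i /=; rewrite t'K.
  rewrite -a'E /=; apply: c_const => [i|psi].
    by rewrite /=; have [b Bb <-] := a'B i; rewrite tK.
  by rewrite -a'a; exact: automorphism_same_type.
exists (t \o a); last exact: c_const.
split=> [i|]; first by exists (a i).
exact: automorphism_same_type.
Qed.

(** All the formulas of a definable coloring use finitely many parameters,
enumerated by e; each of the external types is the type of e over M. *)
Lemma EDEERP_DEERP : EDEERP M -> DEERP M.
Proof.
move=> edeerp B k a n c fB aB [phi cphi]; apply: edeerp => //.
have [pt] := carrier_inhabited M.
have [i A A' AA' H M' v w vw|P fP Pphi] :=
    finite_common_bound (fun i => sat_support (phi i)).
  by apply: H => z /AA'; exact: vw.
(* The point pt makes e nonempty, so that variables outside the support of the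
   formulas can be renamed too. *)
pose Q := pt |` (fun z => if z is inr x then x else pt) @` P.
have fQ : finite_set Q.
  by rewrite finite_setU; split; [exact: finite_set1|exact: finite_image].
have [m [e Qe]] := finite_set_enum fQ.
have /choice[h hP] : forall z : 'I_k + M, exists z' : 'I_k + 'I_m,
    P z -> forall x : 'I_k -> M, assign x e z' = assign x id z.
  move=> [j|y]; first by exists (inl j).
  case: (pselect (Q y)) => [|nQy]; first by rewrite Qe => -[l _ <-]; exists (inr l).
  have : Q pt by left.
  rewrite Qe => -[l _ _]; exists (inr l) => Py; case: nQy.
  by right; exists (inr y).
exists m, (fun i => rename h (phi i)), (fun _ => [set psi | sat (assign e id) psi]).
split=> [_|a' /cphi ca i].
  split=> [F _ FP|psi]; first by exists e.
  exact: EM.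
(* Only the values on the common support P of the formulas matter. *)
have E : sat (assign e id) (subst_left a' (rename h (phi i))) <-> sat (assign a' id) (phi i).
  by rewrite sat_subst_left sat_rename; apply: Pphi => z Pz; exact: hP.
have [c1 c0] := ca i.
by split=> [/E/c1|/= nE]; [|apply: c0 => /E].
Qed.

End Monster.
End Semantics.

Theorem proposition4p7 (L : language) (T : set (sentence L)) (C : structure L) :
  complete_theory T -> monster T C -> NIP T -> (DEERP C <-> EDEERP C).
Proof.
move=> _ [TC [K [K_large C_sat C_hom]]] TNIP; split.
  exact: (DEERP_EDEERP K_large C_sat C_hom TC TNIP).
exact: EDEERP_DEERP.
Qed.
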